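(* Let $\Psi:\mathcal{X}\times\Theta\to\mathbb{R}^q$ be a regular inference function with components $\psi_1,\dots,\psi_q$. Then, for $i=1,\dots,q$, for all $\theta\in\Theta$ and all $z\in\mathcal{Z}$, $$\psi_i(\cdot;\theta)\in F_{IA}(\theta,z).$$
   Context: Setting. $\lambda$ is a $\sigma$-finite measure on a measurable space $(\mathcal{X},\mathcal{A})$; $\mathcal{P}^*=\{p(\cdot;\theta,z)=dP_{\theta z}/d\lambda:\theta\in\Theta,\ z\in\mathcal{Z}\}$ is a family of probability densities, $\Theta\subseteq\mathbb{R}^q$ is open, $\mathcal{Z}$ is an arbitrary set, $(\theta,z)\mapsto p(\cdot;\theta,z)$ is a bijection onto $\mathcal{P}^*$, and all densities are strictly positive. $L^2_0(P)$ is the space of $P$-square-integrable functions with $P$-mean zero; $\langle\cdot,\cdot\rangle_{\theta z}$ is the inner product of $L^2(P_{\theta z})$. Nuisance tangent space. For $\theta\in\Theta$ let $\mathcal{P}^*_\theta=\{p(\cdot;\theta,z):z\in\mathcal{Z}\}$. The nuisance tangent set $T^0_N(\theta,z)$ is the set of $\nu\in L^2_0(P_{\theta z})$ for which there are a set $V\subseteq[0,\infty)$ containing $0$ and having $0$ as an accumulation point, a path $\{p_t\}_{t\in V}\subseteq\mathcal{P}^*_\theta$ and functions $\{r_t\}_{t\in V}\subseteq L^2(P_{\theta z})$ with $p_t=p+tp\nu+tpr_t$ for all $t\in V$, where $p=p(\cdot;\theta,z)$, and $\|r_t\|_{L^2(P_{\theta z})}\to0$ as $t\downarrow0$. $T_N(\theta,z)$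 is the $L^2_0(P_{\theta z})$-closure of the linear span of $T_N^0(\theta,z)$, and $T_N^\perp(\theta,z)$ is its orthogonal complement in $L^2_0(P_{\theta z})$. The space $F_{IA}$. For $z,z_*\in\mathcal{Z}$, the $m$-parallel transport of $a\in L^2_0(P_{\theta z_*})$ from $z_*$ to $z$ is $\overset{(m)}{\Pi}{}_{z_*}^{z}a=\frac{p(\cdot;\theta,z_* )}{p(\cdot;\theta,z)}\,a$. Define $F_{IA}(\theta,z)=\{r\in T_N^\perp(\theta,z):\ \langle\overset{(m)}{\Pi}{}_{z_*}^{z}\nu_*,r\rangle_{\theta z}=0\ \text{for all } z_*\in\mathcal{Z},\ \nu_*\in T_N(\theta,z_* )\}$ (it is understood that the transported functions lie in $L^2(P_{\theta z})$, so that the inner products are defined). Regular inference function. $\Psi:\mathcal{X}\times\Theta\to\mathbb{R}^q$, measurable in $x$, with components $\psi_1,\dots,\psi_q$, is a regular inference function if for all $\theta\in\Theta$, $z\in\mathcal{Z}$, $i,j\in\{1,\dots,q\}$: $\psi_i(\cdot;\theta)\in L^2_0(P_{\theta z})$; $\partial\psi_i(\cdot;\theta)/\partial\theta_j$ exists almost everywhere; $\frac{\partial}{\partial\theta_j}\int\psi_i(x;\theta)p(x;\theta,z)\lambda(dx)=\int\frac{\partial}{\partial\theta_j}[\psi_i(x;\theta)p(x;\theta,z)]\lambda(dx)$; the $q\times q$ matrix with entries $\mathrm{E}_{\theta z}\{\partial\psi_i(\cdot;\theta)/\partial\theta_j\}$ is well defined and nonsingular; and the $q\times q$ matrix $\mathrm{E}_{\theta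 z}\{\Psi(\cdot;\theta)\Psi^T(\cdot;\theta)\}$ is positive definite. *)

(* Defs.v *)
(* MathComp-Analysis *)
From HB Require Import structures.
From mathcomp Require Import all_boot all_order all_algebra.
From mathcomp Require Import all_classical all_reals all_analysis.

Set Implicit Arguments.
Unset Strict Implicit.
Unset Printing Implicit Defensive.

Import Order.TTheory GRing.Theory Num.Theory.
Import numFieldNormedType.Exports.

Local Open Scope classical_set_scope.
Local Open Scope ring_scope.

(* Elements of L^2 spaces are represented by functions; equalities between
   them are understood almost everywhere. *)

Section L2.
Context {d : measure_display} {X : measurableType d} {R : realType}.

Definition L20 (P : probability X R) : set (X -> R) :=
  [set f | f \in Lfun P 2%:E /\ ('E_P[f] = 0)%E].

Definition inner (P : probability X R) (f g : X -> R) : R :=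
  \int[P]_x (f x * g x).

Definition lin_span (S : set (X -> R)) : set (X -> R) :=
  [set f | exists n (c : 'I_n -> R) (g : 'I_n -> X -> R),
     (forall i, S (g i)) /\ f = (fun x => \sum_(i < n) c i * g i x)].

Definition L20_closure (P : probability X R) (S : set (X -> R)) :
    set (X -> R) :=
  [set f | L20 P f /\
     forall e : R, 0 < e -> exists2 g, S g &
       ('N[P]_2%:E[EFin \o (f \- g)%R] < e%:E)%E].

Definition L20_orth (P : probability X R) (S : set (X -> R)) : set (X -> R) :=
  [set r | L20 P r /\ forall f, S f -> inner P f r = 0].

(* [f] need only be meaningful almost everywhere (e.g. a derivative that exists
   almost everywhere, extended by a default value): it agrees almost everywhere
   with an integrable function whose integral is [v]. *)
Definition ae_integral (mu : {measure set X -> \bar R}) (f : X -> R) (v : R) :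
    Prop :=
  exists g : X -> R,
    [/\ mu.-integrable setT (EFin \o g), {ae mu, forall x, f x = g x}
      & \int[mu]_x g x = v].

End L2.

Definition posdefmx {R : realType} {q : nat} (A : 'M[R]_q) : Prop :=
  A^T = A /\ forall u : 'cV[R]_q, u != 0 -> 0 < (u^T *m A *m u) 0 0.

Section Model.
Context {d : measure_display} {X : measurableType d} {R : realType}.
Context (lambda : {sigma_finite_measure set X -> \bar R}).
Context {q : nat} (Theta : set 'rV[R]_q) {Z : Type}.
(* Only the values at parameters of [Theta] are meaningful. *)
Context (P : 'rV[R]_q -> Z -> probability X R).
Context (p : 'rV[R]_q -> Z -> X -> R).

Record density_family : Prop := DensityFamily {
  Theta_open : open Theta;
  density_measurable : forall theta z, Theta theta ->
    measurable_fun setT (p theta z);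
  density_gt0 : forall theta z x, Theta theta -> 0 < p theta z x;
  densityE : forall theta z A, Theta theta -> measurable A ->
    P theta z A = (\int[lambda]_(x in A) (p theta z x)%:E)%E;
  density_inj : set_inj (Theta `*` [set: Z]) (fun u => p u.1 u.2) }.

Definition Pstar_at (theta : 'rV[R]_q) : set (X -> R) := range (p theta).

Definition nuisance_tangent_set (theta : 'rV[R]_q) (z : Z) : set (X -> R) :=
  [set nu | L20 (P theta z) nu /\
    exists V : set R,
      [/\ V `<=` [set t | 0 <= t], V 0, limit_point V 0 &
       exists p_ r : R -> X -> R,
        [/\ forall t, V t -> Pstar_at theta (p_ t),
            forall t, V t -> r t \in Lfun (P theta z) 2%:E,
            forall t, V t -> {ae lambda, forall x,
              p_ t x = p theta z x + t * p theta z x * nu x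
                                   + t * p theta z x * r t x} &
            'N[P theta z]_2%:E[EFin \o r t]%E @[t --> within V 0^'+] --> 0%E]]].

Definition nuisance_tangent_space (theta : 'rV[R]_q) (z : Z) : set (X -> R) :=
  L20_closure (P theta z) (lin_span (nuisance_tangent_set theta z)).

Definition nuisance_tangent_orth (theta : 'rV[R]_q) (z : Z) : set (X -> R) :=
  L20_orth (P theta z) (nuisance_tangent_space theta z).

Definition mtransport (theta : 'rV[R]_q) (zs z : Z) (a : X -> R) : X -> R :=
  fun x => p theta zs x / p theta z x * a x.

(* The transported functions lie in [L^2], so that the inner products in the
   definition of [F_IA] make sense. *)
Definition mtransport_L2 : Prop :=
  forall theta z zs nu, Theta theta -> nuisance_tangent_space theta zs nu ->
    mtransport theta zs z nu \in Lfun (P theta z) 2%:E.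

Definition F_IA (theta : 'rV[R]_q) (z : Z) : set (X -> R) :=
  [set r | nuisance_tangent_orth theta z r /\
    forall zs nu, nuisance_tangent_space theta zs nu ->
      inner (P theta z) (mtransport theta zs z nu) r = 0].

(* [Psi] is total in the parameter; as [Theta] is open, its values outside
   [Theta] play no role in the partial derivatives ['D_(delta_mx 0 j)] at
   points of [Theta]. *)
Record regular_inference_function (Psi : X -> 'rV[R]_q -> 'cV[R]_q) : Prop :=
  RegularInferenceFunction {
  rif_measurable : forall theta i, Theta theta ->
    measurable_fun setT (fun x => Psi x theta i 0);
  rif_L20 : forall theta z i, Theta theta ->
    L20 (P theta z) (fun x => Psi x theta i 0);
  rif_derivable : forall theta (i j : 'I_q), Theta theta ->
    {ae lambda, forall x,
      derivable (fun th => Psi x th i 0) theta (delta_mx 0 j)};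
  rif_interchange : forall theta z (i j : 'I_q), Theta theta ->
    {ae lambda, forall x,
      derivable (fun th => Psi x th i 0 * p th z x) theta (delta_mx 0 j)} /\
    exists2 v : R,
      is_derive theta (delta_mx 0 j)
        (fun th => \int[lambda]_x (Psi x th i 0 * p th z x)) v &
      ae_integral lambda
        (fun x => 'D_(delta_mx 0 j) (fun th => Psi x th i 0 * p th z x) theta)
        v;
  rif_sensitivity : forall theta z, Theta theta ->
    exists2 S : 'M[R]_q,
      forall i j, ae_integral (P theta z)
        (fun x => 'D_(delta_mx 0 j) (fun th => Psi x th i 0) theta) (S i j) &
      S \in unitmx;
  rif_variability : forall theta z, Theta theta ->
    posdefmx (\matrix_(i, j)
      \int[P theta z]_x (Psi x theta *m (Psi x theta)^T) i j) }.

End Model.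

(* Main.v *)
(* Orthogonality to a fixed square-integrable function passes from a set to the
   closure of its linear span, so it suffices to treat a direction [nu] of the
   nuisance tangent set. All densities with the same [theta] integrate
   [psi_i(.; theta)] to [0], hence no path with [theta] fixed changes this
   integral and its derivative, the inner product of [nu] and [psi_i], vanishes.
   The m-parallel transport is dual to a change of density: the inner product
   at [z] of [r] with a transported [nu] is the inner product of [r] and [nu] at
   [z_*], so that membership in [F_IA] follows from the orthogonality at every
   [z_*]. *)
Require Import Defs.
From HB Require Import structures.
From mathcomp Require Import all_boot all_order all_algebra.
From mathcomp Require Import all_classical all_reals all_analysis.
From mathcomp Require Import measurable_realfun ring.
Import Order.TTheory GRing.Theory Num.Theory.
Import numFieldNormedType.Exports.
Local Open Scope classical_set_scope.
Local Open Scope ring_scope.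

(** * Integration against a probability measure given by a density *)

Section Density.
Context {d : measure_display} {X : measurableType d} {R : realType}.
Context (mu : {sigma_finite_measure set X -> \bar R}).
Context (P : probability X R) (p : X -> R).
Hypothesis mp : measurable_fun setT p.
Hypothesis p_ge0 : forall x, 0 <= p x.
Hypothesis PE : forall A, measurable A -> P A = (\int[mu]_(x in A) (p x)%:E)%E.

Lemma density_integrable : mu.-integrable setT (EFin \o p).
Proof.
apply/integrableP; split; first exact/measurable_EFinP.
under eq_integral do rewrite /= ger0_norm//.
by rewrite -PE// probability_setT ltry.
Qed.

Lemma density_dominates : P `<< mu.
Proof.
apply/null_content_dominatesP => A mA muA0.
rewrite PE//; apply: null_set_integral => //.
by apply: measurable_funTS; exact/measurable_EFinP.
Qed.

(** The Radon-Nikodym derivative of [P] and the density [p] have the same [mu]-integral over every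
    measurable set, so they agree almost everywhere; the change of variables for the former then
    holds for [p]. *)
Lemma ge0_integral_density (h : X -> \bar R) :
  (forall x, 0 <= h x)%E -> measurable_fun setT h ->
  (\int[P]_x h x = \int[mu]_x (h x * (p x)%:E))%E.
Proof.
move=> h0 mh; have dom := density_dominates.
rewrite -(Radon_Nikodym_SigmaFinite.change_of_variables dom)//.
have mf := measurable_int mu (Radon_Nikodym_SigmaFinite.f_integrable dom).
apply: ae_eq_integral => //.
- exact: emeasurable_funM.
- by apply: emeasurable_funM => //; exact/measurable_EFinP.
apply: ae_eqe_mul2l; apply: integral_ae_eq => //.
- exact: Radon_Nikodym_SigmaFinite.f_integrable.
- exact/measurable_EFinP.
- by move=> A _ mA; rewrite -PE// -Radon_Nikodym_SigmaFinite.f_integral.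
Qed.

(** Multiplication by a nonnegative [p] commutes with taking positive and negative parts, which
    reduces this to the nonnegative case. *)
Lemma integral_density (h : X -> \bar R) : measurable_fun setT h ->
  (\int[P]_x h x = \int[mu]_x (h x * (p x)%:E))%E.
Proof.
move=> mh; rewrite [LHS]integralE [RHS]integralE.
rewrite !ge0_integral_density//; last 2 first.
- exact: measurable_funeneg.
- exact: measurable_funepos.
congr (_ - _)%E; apply: eq_integral => x _.
- by rewrite !funeposE maxe_pMl ?lee_fin// mul0e.
- by rewrite !funenegE -mulNe maxe_pMl ?lee_fin// mul0e.
Qed.

End Density.

(** * Square-integrable functions and their inner product *)

Section L2.
Context {d : measure_display} {X : measurableType d} {R : realType}.
Context (P : probability X R).
Implicit Types f g psi : X -> R.

Lemma Lfun2_measurable f : f \in Lfun P 2%:E -> measurable_fun setT f.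
Proof. by rewrite inE => /andP[/[!inE]]. Qed.

Lemma Lfun2_fin_num f : f \in Lfun P 2%:E ->
  'N[P]_2%:E[EFin \o f]%E \is a fin_num.
Proof.
by rewrite inE => /andP[_ /[!inE]/= ffin]; rewrite ge0_fin_numE ?Lnorm_ge0.
Qed.

Lemma Lfun2D f g : f \in Lfun P 2%:E -> g \in Lfun P 2%:E ->
  (fun x => f x + g x) \in Lfun P 2%:E.
Proof. by move=> fP gP; exact: (Lfun_addr_closed P (lee1n 2)).2. Qed.

Lemma Lfun2Z (a : R) f : f \in Lfun P 2%:E ->
  (fun x => a * f x) \in Lfun P 2%:E.
Proof.
move=> fP; have -> : (fun x => a * f x) = a \o* f.
  by apply/funext => x /=; rewrite mulrC.
by apply: Lfun_scale => //; rewrite ler1n.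
Qed.

Lemma Lfun2B f g : f \in Lfun P 2%:E -> g \in Lfun P 2%:E ->
  f \- g \in Lfun P 2%:E.
Proof.
move=> fP gP; have -> : f \- g = (fun x => f x + (-1) * g x).
  by apply/funext => x /=; rewrite mulN1r.
by apply: Lfun2D => //; exact: Lfun2Z.
Qed.

Lemma Lfun2_sum n (c : 'I_n -> R) (g : 'I_n -> X -> R) :
  (forall i, g i \in Lfun P 2%:E) ->
  (fun x => \sum_(i < n) c i * g i x) \in Lfun P 2%:E.
Proof.
elim: n c g => [|n IH] c g gP.
  have -> : (fun x => \sum_(i < 0) c i * g i x) = cst 0.
    by apply/funext => x; rewrite big_ord0.
  exact: Lfun_cst.
have -> : (fun x => \sum_(i < n.+1) c i * g i x) =
    (fun x => (c ord0 * g ord0 x) +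
       \sum_(i < n) (c \o lift ord0) i * (g \o lift ord0) i x).
  by apply/funext => x; rewrite big_ord_recl.
by apply: Lfun2D; [exact: Lfun2Z|apply: IH => i; exact: gP].
Qed.

Lemma inner_integrable f g : f \in Lfun P 2%:E -> g \in Lfun P 2%:E ->
  P.-integrable setT (EFin \o (fun x => f x * g x)).
Proof. by move=> fP gP; apply/Lfun1_integrable; exact: Lfun2_mul_Lfun1. Qed.

Lemma innerDl f g psi : f \in Lfun P 2%:E -> g \in Lfun P 2%:E ->
  psi \in Lfun P 2%:E ->
  inner P (fun x => f x + g x) psi = inner P f psi + inner P g psi.
Proof.
move=> fP gP psiP; rewrite /inner -RintegralD//; try exact: inner_integrable.
by apply: eq_Rintegral => x _; rewrite mulrDl.
Qed.

Lemma innerZl (a : R) f psi : f \in Lfun P 2%:E -> psi \in Lfun P 2%:E ->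
  inner P (fun x => a * f x) psi = a * inner P f psi.
Proof.
move=> fP psiP; rewrite /inner -RintegralZl//; last exact: inner_integrable.
by apply: eq_Rintegral => x _; rewrite mulrA.
Qed.

Lemma innerBl f g psi : f \in Lfun P 2%:E -> g \in Lfun P 2%:E ->
  psi \in Lfun P 2%:E ->
  inner P (f \- g) psi = inner P f psi - inner P g psi.
Proof.
move=> fP gP psiP; have -> : f \- g = (fun x => f x + (-1) * g x).
  by apply/funext => x /=; rewrite mulN1r.
by rewrite innerDl ?innerZl ?mulN1r//; exact: Lfun2Z.
Qed.

Lemma inner_suml n (c : 'I_n -> R) (g : 'I_n -> X -> R) psi :
  (forall i, g i \in Lfun P 2%:E) -> psi \in Lfun P 2%:E ->
  inner P (fun x => \sum_(i < n) c i * g i x) psi =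
  \sum_(i < n) c i * inner P (g i) psi.
Proof.
elim: n c g => [|n IH] c g gP psiP.
  rewrite big_ord0 /inner; under eq_Rintegral do rewrite big_ord0 mul0r.
  by rewrite Rintegral_cst// mul0r.
under [X in inner P X]eq_fun do rewrite big_ord_recl.
rewrite innerDl ?innerZl//; last 2 first.
- exact: Lfun2Z.
- by apply: Lfun2_sum.
by rewrite big_ord_recl IH.
Qed.

(** The L^1 norm of the product dominates the absolute value of the integral, and Hoelder's
    inequality with both exponents equal to 2 bounds that norm. *)
Lemma cauchy_schwarz f g : f \in Lfun P 2%:E -> g \in Lfun P 2%:E ->
  (`|inner P f g|%:E <=
     'N[P]_2%:E[EFin \o f] * 'N[P]_2%:E[EFin \o g])%E.
Proof.
move=> fP gP; have ifg := inner_integrable f g fP gP.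
apply: (@le_trans _ _ ('N[P]_1[EFin \o (f \* g)%R])%E); last first.
  apply: hoelder; rewrite ?ltr0n//; try exact: Lfun2_measurable.
  by rewrite [RHS]splitr !div1r.
apply: (@le_trans _ _ (\int[P]_x `|f x * g x|)%:E).
  by rewrite lee_fin; exact: le_normr_Rintegral.
rewrite Lnorm1 /Rintegral fineK//.
by apply: integrable_fin_num => //; exact: integrable_norm.
Qed.

(** By Cauchy-Schwarz [a] is bounded by arbitrarily small multiples of the norm of [psi]. The small
    [u] will be the error of an approximation from the linear span, and later the remainder [r t] of
    a path. *)
Lemma eq0_inner_approx psi (a : R) : psi \in Lfun P 2%:E ->
  (forall e : R, 0 < e -> exists u, [/\ u \in Lfun P 2%:E,
     ('N[P]_2%:E[EFin \o u] < e%:E)%E & `|a| <= `|inner P u psi|]) ->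
  a = 0.
Proof.
move=> psiP approx; apply/eqP; rewrite -normr_eq0; apply/eqP.
set C := fine ('N[P]_2%:E[EFin \o psi])%E.
have C0 : 0 <= C by rewrite fine_ge0// Lnorm_ge0.
apply/eqP; rewrite eq_le normr_ge0 andbT; apply/ler_addgt0Pl => e e0.
(* The divisor is [C + 1] rather than [C], since the norm [C] of [psi] may vanish. *)
rewrite addr0; have C1 : 0 < C + 1 by rewrite ltr_wpDl.
have [u [uP ue au]] := approx (e / (C + 1)) (divr_gt0 e0 C1).
apply: (le_trans au); rewrite -lee_fin; apply: le_trans.
  exact: cauchy_schwarz uP psiP.
rewrite -(fineK (Lfun2_fin_num psi psiP)) -/C.
apply: le_trans (_ : ((e / (C + 1))%:E * C%:E <= _)%E).
  by apply: lee_wpmul2r; [rewrite lee_fin|exact: ltW].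
rewrite -EFinM lee_fin mulrAC ler_pdivrMr// ler_pM2l//.
by rewrite lerDl.
Qed.

Lemma inner_closure_lin_span_eq0 (S : set (X -> R)) psi :
  psi \in Lfun P 2%:E ->
  (forall f, S f -> f \in Lfun P 2%:E /\ inner P f psi = 0) ->
  forall f, L20_closure P (lin_span S) f -> inner P f psi = 0.
Proof.
move=> psiP S0 f [[fP _] fS]; apply: (eq0_inner_approx psi _ psiP) => e e0.
have [_ [n [c [g [Sg ->]]]] fge] := fS e e0.
have gP i : g i \in Lfun P 2%:E by have [] := S0 _ (Sg i).
(* The witness, fixed by unification with [fge], is [f] minus its approximant from the span; the
   approximant is orthogonal to [psi], so both have the same inner product with [psi]. *)
eexists; split; [|exact: fge|].
- by apply: Lfun2B => //; exact: Lfun2_sum.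
- rewrite innerBl//; last exact: Lfun2_sum.
  rewrite inner_suml// big1 ?subr0// => i _.
  by have [_ ->] := S0 _ (Sg i); rewrite mulr0.
Qed.

End L2.

(** * Orthogonality within the model, at fixed [theta] *)

Section Model.
Context {d : measure_display} {X : measurableType d} {R : realType}.
Context (lambda : {sigma_finite_measure set X -> \bar R}).
Context {q : nat} (Theta : set 'rV[R]_q) {Z : Type}.
Context (P : 'rV[R]_q -> Z -> probability X R).
Context (p : 'rV[R]_q -> Z -> X -> R).
Hypothesis dens : density_family lambda Theta P p.

Lemma integral_density_family theta z (h : X -> R) : Theta theta ->
  measurable_fun setT h ->
  (\int[P theta z]_x (h x)%:E = \int[lambda]_x (h x * p theta z x)%:E)%E.
Proof.
move=> Tt mh; have [_ mp pgt0 PE _] := dens.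
under [RHS]eq_integral do rewrite EFinM.
apply: integral_density => //.
- exact: mp.
- by move=> x; rewrite ltW// pgt0.
- by move=> A mA; exact: PE.
- exact/measurable_EFinP.
Qed.

(** Both sides are the [lambda]-integral of [nu * r * p theta zs]: the positive density at [z]
    cancels against the denominator of the transport. *)
Lemma inner_mtransport theta z zs (nu r : X -> R) : Theta theta ->
  measurable_fun setT nu -> measurable_fun setT (mtransport p theta zs z nu) ->
  measurable_fun setT r ->
  inner (P theta z) (mtransport p theta zs z nu) r = inner (P theta zs) nu r.
Proof.
move=> Tt mnu mtr mr; have [_ _ pgt0 _ _] := dens.
rewrite /inner /Rintegral !(integral_density_family _ _ _ Tt); last 2 first.
- exact: measurable_funM.
- exact: measurable_funM.
congr fine; apply: eq_integral => x _; congr EFin.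
by rewrite /mtransport; field; rewrite gt_eqF// pgt0.
Qed.

(* Integrating [psi] against the expansion of [p_ t] and dividing by [t] gives
   [inner nu psi = - inner (r t) psi]. *)
Lemma inner_nuisance_tangent_set_eq0 theta z (nu psi : X -> R) : Theta theta ->
  (forall z', L20 (P theta z') psi) ->
  nuisance_tangent_set lambda P p theta z nu -> inner (P theta z) nu psi = 0.
Proof.
move=> Tt psiL20 [[nuP _] [V [Vge0 _ V0 [p_ [r [pV rP expand rcvg]]]]]].
have psiP := (psiL20 z).1; have mpsi := Lfun2_measurable _ _ psiP.
apply: (eq0_inner_approx _ psi _ psiP) => e e0.
have near0 : \forall t \near within V 0^'+,
    ('N[P theta z]_2%:E[EFin \o r t] < e%:E)%E.
  apply: (rcvg [set y | y < e%:E]%E); apply: open_nbhs_nbhs; split.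
    exact: open_ereal_lt_ereal.
  by rewrite /= lte_fin.
(* Unfolded, [near0] gives a neighbourhood of 0 where the bound holds for positive points of [V].
   Accumulation at 0 yields a nonzero [t] of [V] in it, which is positive because [V] lies in the
   nonnegative reals. *)
have [t [tn0 Vt tsmall]] := V0 _ near0.
have t0 : 0 < t by rewrite lt_neqAle eq_sym tn0; exact: Vge0.
exists (r t); split; [exact: rP|exact: tsmall|].
have uP : (fun x => nu x + r t x) \in Lfun (P theta z) 2%:E.
  by apply: Lfun2D => //; exact: rP.
have iupsi := inner_integrable _ _ _ uP psiP.
have ipsi : (P theta z).-integrable setT (EFin \o psi).
  by apply/Lfun1_integrable; apply: Lfun_subset12 => //; exact: fin_num_measure.
have mean0 z' : (\int[P theta z']_x (psi x)%:E = 0)%E.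
  by have [_] := psiL20 z'; rewrite unlock.
have mh : measurable_fun setT (fun x => psi x + t * ((nu x + r t x) * psi x)).
  apply: measurable_funD => //; apply: measurable_funM => //.
  by apply: measurable_funM => //; exact: Lfun2_measurable uP.
(* Multiplied by [p theta z], the integrand is almost everywhere [psi * p_ t], and [p_ t] is the
   density of some [zt] with the same [theta], under which [psi] has mean 0. *)
have h0 : (\int[P theta z]_x (psi x + t * ((nu x + r t x) * psi x))%:E = 0)%E.
  have [zt _ ptE] := pV t Vt.
  rewrite -(mean0 zt) !(integral_density_family _ _ _ Tt)//.
  have [_ mp _ _ _] := dens.
  apply: ae_eq_integral => //.
  - by apply/measurable_EFinP; apply: measurable_funM => //; exact: mp.
  - by apply/measurable_EFinP; apply: measurable_funM => //; exact: mp.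
  apply: filterS (expand t Vt) => x pE _; congr EFin.
  by rewrite ptE pE; ring.
have : t * inner (P theta z) (fun x => nu x + r t x) psi = 0.
  have : \int[P theta z]_x (psi x + t * ((nu x + r t x) * psi x)) = 0.
    by rewrite /Rintegral h0.
  rewrite RintegralD//; last exact: integrableZl iupsi.
  by rewrite [X in X + _]/Rintegral mean0 add0r RintegralZl.
move/eqP; rewrite mulf_eq0 gt_eqF//= innerDl//; last exact: rP.
by rewrite addr_eq0 => /eqP ->; rewrite normrN.
Qed.

End Model.

Theorem proposition13 (d : measure_display) (X : measurableType d)
    (R : realType) (lambda : {sigma_finite_measure set X -> \bar R})
    (q : nat) (Theta : set 'rV[R]_q) (Z : Type)
    (P : 'rV[R]_q -> Z -> probability X R) (p : 'rV[R]_q -> Z -> X -> R)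
    (Psi : X -> 'rV[R]_q -> 'cV[R]_q) :
  density_family lambda Theta P p ->
  mtransport_L2 lambda Theta P p ->
  regular_inference_function lambda Theta P p Psi ->
  forall (i : 'I_q) (theta : 'rV[R]_q) (z : Z), Theta theta ->
    F_IA lambda P p theta z (fun x => Psi x theta i 0).
Proof.
move=> dens mtL2 rif i theta z Tt; set psi := fun x => _.
have psiL20 z' : L20 (P theta z') psi by exact: rif_L20 rif _ _ _ Tt.
(* Stated for every nuisance value: it is applied at [z] for the orthogonal complement and at [zs]
   for the transported directions. *)
have orth z' nu : nuisance_tangent_space lambda P p theta z' nu ->
    inner (P theta z') nu psi = 0.
  apply: inner_closure_lin_span_eq0; first exact: (psiL20 z').1.
  move=> f Tf; split; first exact: Tf.1.1.
  exact: inner_nuisance_tangent_set_eq0 dens _ _ _ _ Tt psiL20 Tf.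
split; first by split => // f; exact: orth.
move=> zs nu Tnu; rewrite (inner_mtransport _ _ _ _ dens)//.
- exact: orth.
- exact: Lfun2_measurable Tnu.1.1.
- exact: Lfun2_measurable (mtL2 _ _ _ _ Tt Tnu).
- exact: Lfun2_measurable (psiL20 z).1.
Qed.
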